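(* Assume that the following conditions are fulfilled: (a) $a\in\mathbb{R}^{\ell}$, $F\subseteq\mathbb{R}^{\ell}$ is a nonempty closed set. (b) $H$ is a proper closed convex subset of $\mathbb{R}^{\ell}$ with $k\in 0^+H\setminus(-0^+H)$. (c) There exist a polyhedral cone $C\subset\mathbb{R}^{\ell}$, some $h\in H$ and $u\in\mathbb{R}^{\ell}$ such that $$h-H\subset\operatorname{int}C\cup\{0\}\quad\text{and}\quad (F-u)\cap\operatorname{int}C=\emptyset.$$ (d) The problem $(P_{F,a,H,k})$ has a feasible solution. Then $M_{F,a,H,k}$ is nonempty and compact.
   Context: $\ell\ge 1$ is an integer. For $A\subseteq\mathbb{R}^{\ell}$, the recession cone is $0^+A:=\{u\in\mathbb{R}^{\ell}\mid A+\mathbb{R}_+u\subseteq A\}$, where $\mathbb{R}_+=[0,\infty)$; $\operatorname{int}$ denotes the topological interior. A proper subset of $\mathbb{R}^{\ell}$ is a nonempty subset different from $\mathbb{R}^{\ell}$. A polyhedral cone is a set of the form $\{x\in\mathbb{R}^{\ell}\mid Bx\le 0\}$ for some real matrix $B$. $(P_{F,a,H,k})$ is the problem of minimizing $t$ over all pairs $(y,t)\in F\times\mathbb{R}$ with $y\in a-H+tk$ (the feasible solutions). $M_{F,a,H,k}$ is the set of its optimal solutions $y$, i.e. of all $y\in F$ for which there is $t\in\mathbb{R}$ such that $(y,t)$ is feasible and $t\le s$ for every feasible $(z,s)$. *)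

(* Defs.v *)
From mathcomp Require Import all_boot all_order all_algebra.
From mathcomp Require Import all_classical all_reals all_analysis.

Set Implicit Arguments.
Unset Strict Implicit.
Unset Printing Implicit Defensive.

Import Order.TTheory GRing.Theory Num.Theory.
Import numFieldNormedType.Exports.

Local Open Scope classical_set_scope.
Local Open Scope ring_scope.

Definition proper_set (T : Type) (A : set T) : Prop :=
  A !=set0 /\ A <> setT.

Definition recession_cone (R : realType) (l : nat) (A : set 'rV[R]_l) :
    set 'rV[R]_l :=
  [set u | [set x + t *: u | x in A & t in `[0, +oo[] `<=` A].

(* The points are row vectors, so the product of B with the point x, seen as a
   column, is B *m x^T. *)
Definition polyhedral_cone (R : realType) (l : nat) (C : set 'rV[R]_l) : Prop :=
  exists (m : nat) (B : 'M[R]_(m, l)),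
    C = [set x : 'rV[R]_l | forall i, (B *m x^T) i ord0 <= 0].

Definition feasible (R : realType) (l : nat) (F : set 'rV[R]_l)
    (a : 'rV[R]_l) (H : set 'rV[R]_l) (k : 'rV[R]_l) : set ('rV[R]_l * R) :=
  [set p | F p.1 /\ [set a - x + p.2 *: k | x in H] p.1].

Definition solution_set (R : realType) (l : nat) (F : set 'rV[R]_l)
    (a : 'rV[R]_l) (H : set 'rV[R]_l) (k : 'rV[R]_l) : set 'rV[R]_l :=
  [set y | F y /\ exists t : R, feasible F a H k (y, t) /\
     forall (z : 'rV[R]_l) (s : R), feasible F a H k (z, s) -> t <= s].

(* Main.v *)
(* Let phi_i be the forms defining C by nonzero rows. Then int C is the set where
   all phi_i are negative, so every phi_i is positive on (H - h) \ {0} and on k,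
   and each y in F satisfies phi_i (y - u) >= 0 for some i. For such y in
   a - H + t k with t <= t0 this bounds t from below and keeps a - y + t k in
   H intersected with a half-space of phi_i, which is bounded. Hence the feasible
   pairs with t <= t0 form a compact set, on which t attains its minimum. *)

Require Import Defs.
From HB Require Import structures.
From mathcomp Require Import all_boot all_order all_algebra.
From mathcomp Require Import all_classical all_reals all_analysis.
From mathcomp Require Import lra.

Set Implicit Arguments.
Unset Strict Implicit.
Unset Printing Implicit Defensive.

Import Order.TTheory GRing.Theory Num.Theory.
Import numFieldNormedType.Exports.

Local Open Scope classical_set_scope.
Local Open Scope ring_scope.

(** * Continuity of linear forms and affine maps *)

Lemma scalar_continuous (R : realType) (l : nat) (phi : {scalar 'rV[R]_l}) :
  continuous (phi : 'rV[R]_l -> R).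
Proof.
have -> : (phi : 'rV[R]_l -> R) =
    fun x => \sum_(j < l) x ord0 j * phi (delta_mx ord0 j).
  apply/funext => x; rewrite [in LHS](row_sum_delta x) linear_sum.
  by apply: eq_bigr => j _; rewrite linearZ.
apply: continuous_big; first exact: add_continuous.
move=> j _ x; apply: (@continuousM _ _ (fun x : 'rV[R]_l => x ord0 j)).
  exact: coord_continuous.
exact: cst_continuous.
Qed.

Lemma continuous_dist (R : realType) (V : normedModType R) (h : V) :
  continuous (fun x : V => `|x - h|).
Proof.
by move=> x; apply: cvg_norm; apply: cvgB => //; exact: cvg_cst.
Qed.

Lemma continuous_subr (R : realType) (V : normedModType R) (h : V) :
  continuous (fun x : V => x - h).
Proof. by move=> x; apply: cvgB => //; exact: cvg_cst. Qed.

Lemma continuous_reflect (R : realType) (V : normedModType R) (a v : V) :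
  continuous (fun x : V => a - x + v).
Proof.
by move=> x; apply: cvgD; [apply: cvgB => //; exact: cvg_cst|exact: cvg_cst].
Qed.

Lemma continuous_along (R : realType) (V : normedModType R) (a k : V) :
  continuous (fun p : V * R => a - p.1 + p.2 *: k).
Proof.
move=> p; apply: cvgD.
  by apply: cvgB; [exact: cvg_cst|exact: cvg_fst].
by apply: cvgZr_tmp; exact: cvg_snd.
Qed.

(** * Boundedness of half-space sections of a convex set *)

Lemma convex_set_segment (R : realType) (V : lmodType R) (H : set V)
    (h x : V) (s : R) :
  convex_set H -> H h -> H x -> 0 <= s <= 1 -> H (h + s *: (x - h)).
Proof.
move=> cH Hh Hx s01.
have := cH x h (Itv01 (andP s01).1 (andP s01).2) (mem_set Hx) (mem_set Hh).
rewrite inE; congr (H _).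
rewrite /conv /= scalerBr [h + _]addrC -addrA; congr (_ + _).
by rewrite /unstable.onem scalerBl scale1r addrC.
Qed.

(* Otherwise the points of H in the half-space would have directions from h
   accumulating at a unit vector v with h + v in H and phi v <= 0. *)
Lemma convex_halfspace_bounded (R : realType) (l : nat) (H : set 'rV[R]_l)
    (h : 'rV[R]_l) (phi : {scalar 'rV[R]_l}) (b : R) :
  closed H -> convex_set H -> H h ->
  (forall x, H x -> x != h -> 0 < phi (x - h)) ->
  exists M, forall x, H x -> phi (x - h) <= b -> `|x - h| <= M.
Proof.
move=> clH cH Hh phi_gt0.
pose S := H `&` [set x | `|x - h| = 1].
have cptS : compact S.
  apply: bounded_closed_compact; last first.
    apply: closedI => //.
    have cf := @continuous_dist R 'rV[R]_l h.
    exact: (proj1 (continuous_closedP _) cf _ (@closed_eq R 1)).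
  exists (1 + `|h|); split; first exact: num_real.
  move=> M M1 x [_ /= xh]; apply: le_trans (ltW M1).
  by rewrite -(subrK h x) -xh ler_normD.
(* [d] is the minimum of [phi (x - h)] over the compact set [S]; if [S] is empty, any positive
   number serves. *)
have [d d_gt0 dS] : exists2 d, 0 < d & forall x, S x -> d <= phi (x - h).
  have [[x0 Sx0]|S0] := pselect (S !=set0); last first.
    by exists 1 => // x Sx; case: S0; exists x.
  have cphi : continuous (fun x : 'rV[R]_l => phi (x - h)).
    move=> x; apply: (@continuous_comp _ _ _ (fun x : 'rV[R]_l => x - h) phi).
      exact: continuous_subr.
    exact: scalar_continuous.
  have [c cS cmin] := compact_EVT_min (ex_intro _ x0 Sx0) cptS
    (continuous_subspaceT cphi).
  exists (phi (c - h)); last by move=> x Sx; apply: cmin; rewrite inE.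
  move: cS; rewrite inE => -[Hc /= c1]; apply: phi_gt0 => //.
  by apply: contra_eqN c1 => /eqP ->; rewrite subrr normr0 eq_sym oner_eq0.
(* If [x] is farther than 1 from [h], the segment from [h] to [x] meets [S]; by linearity [d] times
   the distance is at most [phi (x - h) <= b]. *)
exists (Num.max 1 (b / d)) => x Hx xb.
rewrite le_max; have [//|lt1] := leP `|x - h| 1 => /=.
have n0 : 0 < `|x - h| by apply: lt_trans lt1.
rewrite ler_pdivlMr //; apply: le_trans xb.
rewrite -ler_pdivlMl // mulrC.
have := dS (h + `|x - h|^-1 *: (x - h)).
rewrite addrAC subrr add0r linearZ /= [X in _ -> _ <= X]mulrC; apply; split => /=.
  apply: convex_set_segment => //.
  by rewrite invr_ge0 ltW //= invf_le1 // ltW.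
rewrite addrAC subrr add0r normrZ gtr0_norm ?invr_gt0 // mulVf //.
by rewrite gt_eqF.
Qed.

(** Named so that a linear structure can be attached to it; the lemmas about [{scalar 'rV[R]_l}]
    then apply to each row of [B]. *)
Definition row_form (R : realType) (m l : nat) (B : 'M[R]_(m, l)) (i : 'I_m)
  (x : 'rV[R]_l) : R := (B *m x^T) i ord0.

Lemma row_form_linear (R : realType) (m l : nat) (B : 'M[R]_(m, l)) (i : 'I_m) :
  scalar (row_form B i).
Proof.
by move=> c x y; rewrite /row_form linearP mulmxDr -scalemxAr mxE [X in X + _]mxE.
Qed.

HB.instance Definition _ (R : realType) (m l : nat) (B : 'M[R]_(m, l))
    (i : 'I_m) :=
  GRing.isLinear.Build R 'rV[R]_l R *%R (row_form B i) (@row_form_linear R m l B i).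

(** With [c] as below, the last premise reads [phi (x - h) <= c + t * phi k]. Since [t <= t0], this
    puts [x] in a bounded section of [H]; since [phi (x - h) >= 0], it also bounds [t] from
    below. *)
Lemma halfspace_translate_bounded (R : realType) (l : nat) (H : set 'rV[R]_l)
    (h k v a : 'rV[R]_l) (phi : {scalar 'rV[R]_l}) (t0 : R) :
  closed H -> convex_set H -> H h -> 0 < phi k ->
  (forall x, H x -> x != h -> 0 < phi (x - h)) ->
  exists M, forall x t, H x -> t <= t0 -> 0 <= phi (a - x + t *: k - v) ->
    `|a - x + t *: k| <= M /\ `|t| <= M.
Proof.
move=> clH cH Hh phik phi_gt0.
pose c := phi (a - h - v).
have [M MH] := @convex_halfspace_bounded R l H h phi (c + t0 * phi k)
  clH cH Hh phi_gt0.
(* [N] bounds the absolute value of every [t] between [- (c / phi k)] and [t0]. *)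
pose N := `|t0| + `|c / phi k|.
exists (`|a - h| + M + N * `|k| + N) => x t Hx tt0 phiy.
have phixh : phi (x - h) <= c + t * phi k.
  rewrite -subr_ge0; apply: le_trans phiy _.
  by rewrite /c !(linearD, linearN, linearZ) /=; lra.
have xhM : `|x - h| <= M.
  by apply: MH => //; apply: le_trans phixh _; rewrite lerD2l ler_pM2r.
have phixh0 : 0 <= phi (x - h).
  have [->|xh] := eqVneq x h; first by rewrite subrr linear0.
  exact/ltW/phi_gt0.
have tN : `|t| <= N.
  have : - (c / phi k) <= t.
    by rewrite -mulNr ler_pdivrMr //; lra.
  rewrite /N ler_norml => tl; apply/andP; split.
    by have := ler_norm (c / phi k); have := normr_ge0 t0; lra.
  by have := ler_norm t0; have := normr_ge0 (c / phi k); lra.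
have N0 : 0 <= N by apply: le_trans tN.
have M0 : 0 <= M by apply: le_trans xhM.
have ah0 := normr_ge0 (a - h).
have Nk0 : 0 <= N * `|k| by rewrite mulr_ge0.
split; last by lra.
have -> : a - x + t *: k = (a - h) - (x - h) + t *: k.
  by rewrite opprB addrA subrK.
have := ler_normD ((a - h) - (x - h)) (t *: k).
have := ler_normB (a - h) (x - h).
have : `|t *: k| <= N * `|k| by rewrite normrZ ler_wpM2r.
by lra.
Qed.

(** * Interior of a polyhedral cone *)

Lemma cvg_along_right (R : realType) (V : normedModType R) (x w : V) :
  x + e *: w @[e --> (0 : R)^'+] --> x.
Proof.
apply: cvg_at_right_filter.
have : x + e *: w @[e --> (0 : R)] --> x + 0 *: w.
  apply: cvgD; first exact: cvg_cst.
  exact: scalel_continuous.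
by rewrite scale0r addr0.
Qed.

(** A small step from [x] along the normal [w = row i B] stays in the cone but raises the [i]-th
    form by a positive multiple of the squared Euclidean length of [w]. *)
Lemma polyhedral_interior_lt0 (R : realType) (m l : nat) (B : 'M[R]_(m, l))
    (x : 'rV[R]_l) (i : 'I_m) :
  [set y : 'rV[R]_l | forall i, (B *m y^T) i ord0 <= 0]° x ->
  row i B != 0 -> (B *m x^T) i ord0 < 0.
Proof.
move=> Cx Bi0; pose w := row i B.
have w_gt0 : 0 < (B *m w^T) i ord0.
  have -> : (B *m w^T) i ord0 = \sum_j B i j ^+ 2.
    by rewrite mxE; apply: eq_bigr => j _; rewrite !mxE.
  rewrite lt_def sumr_ge0 ?andbT => [|j _]; last exact: sqr_ge0.
  apply: contra Bi0; rewrite psumr_eq0 => [/allP B0|j _]; last exact: sqr_ge0.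
  apply/eqP/rowP => j; rewrite !mxE; apply/eqP.
  by have := B0 j (mem_index_enum _); rewrite /= sqrf_eq0.
have cw := @cvg_along_right R 'rV[R]_l x w.
have /cw /= Ce : nbhs x [set y : 'rV[R]_l | forall i, (B *m y^T) i ord0 <= 0].
  exact: Cx.
near (0 : R)^'+ => e.
have e0 : 0 < e by near: e; exact: nbhs_right_gt.
(* Generalizing [i] turns the claim into membership in the cone, which holds for all small
   [e > 0]. *)
have : (B *m (x + e *: w)^T) i ord0 <= 0 by move: (i); near: e.
rewrite linearD linearZ /= mulmxDr -scalemxAr mxE [X in _ + X]mxE.
have := mulr_gt0 e0 w_gt0; lra.
Unshelve. all: by end_near. Qed.

(** Finitely many strict inequalities persist near [x] by continuity, and a zero row gives a form
    that vanishes everywhere. *)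
Lemma lt0_polyhedral_interior (R : realType) (m l : nat) (B : 'M[R]_(m, l))
    (x : 'rV[R]_l) :
  (forall i, row i B != 0 -> (B *m x^T) i ord0 < 0) ->
  [set y : 'rV[R]_l | forall i, (B *m y^T) i ord0 <= 0]° x.
Proof.
move=> Bx; apply: (@filter_forall _ _ _ (nbhs x)) => i.
have [Bi0|/Bx Bix] := eqVneq (row i B) 0.
  apply: (@nearW _ (nbhs x) _) => y /=.
  have -> : (B *m y^T) i ord0 = (row i B *m y^T) ord0 ord0.
    by rewrite -row_mul [RHS]mxE.
  by rewrite Bi0 mul0mx mxE.
apply: (@filterS _ (nbhs x) _ (row_form B i @^-1` [set r | r < 0])).
  by move=> y /ltW.
exact: (@scalar_continuous R l (row_form B i) x _ (lt_nbhsl Bix)).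
Qed.

Theorem proposition10 (R : realType) (l : nat) (hl : (1 <= l)%N)
    (F : set 'rV[R]_l) (a : 'rV[R]_l) (H : set 'rV[R]_l) (k : 'rV[R]_l)
    (F_neq0 : F !=set0) (F_closed : closed F)
    (H_proper : proper_set H) (H_closed : closed H) (H_convex : convex_set H)
    (hk : (recession_cone H `\` [set - v | v in recession_cone H]) k)
    (hC : exists (C : set 'rV[R]_l) (h u : 'rV[R]_l),
        [/\ polyhedral_cone C, H h,
            [set h - x | x in H] `<=` C° `|` [set 0]
          & [set y - u | y in F] `&` C° = set0])
    (hfeas : feasible F a H k !=set0) :
  solution_set F a H k !=set0 /\ compact (solution_set F a H k).
Proof.
case: hC => C [h [u [[m [B ->]] Hh hHC FC]]].
case: hk => recH nrecH.
have recHk x t : H x -> 0 <= t -> H (x + t *: k).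
  by move=> Hx t0; apply: recH; exists x => //; exists t => //=;
    rewrite in_itv /= t0.
(* The zero vector equals its own opposite, so [k = 0] would lie in the negated recession cone. *)
have k_neq0 : k != 0.
  apply: contra_notN nrecH => /eqP k0.
  by exists k; rewrite // k0 oppr0.
have intC x : H x -> x != h -> forall i, row i B != 0 -> 0 < row_form B i (x - h).
  move=> Hx xh i Bi0.
  have [Cx|/eqP] : ([set y : 'rV[R]_l | forall i, (B *m y^T) i ord0 <= 0]°
      `|` [set 0]) (h - x) by apply: hHC; exists x.
    rewrite -opprB linearN oppr_gt0.
    exact: polyhedral_interior_lt0 Cx Bi0.
  by rewrite subr_eq0 eq_sym (negPf xh).
(* The point [h + k] lies in [H] and differs from [h], so [intC] applies to it. *)
have formk i : row i B != 0 -> 0 < row_form B i k.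
  move=> Bi0; have Hhk : H (h + 1 *: k) by exact: recHk.
  have hk0 : h + 1 *: k != h.
    by rewrite scale1r -subr_eq0 addrAC subrr add0r.
  by have := intC _ Hhk hk0 i Bi0; rewrite scale1r addrAC subrr add0r.
(* Otherwise [y - u] would satisfy every strict inequality and lie in the interior of the cone. *)
have Fform y : F y -> exists2 i, row i B != 0 & 0 <= row_form B i (y - u).
  move=> Fy; apply/not_exists2P => noi.
  suff : ([set y - u | y in F] `&`
      [set y : 'rV[R]_l | forall i, (B *m y^T) i ord0 <= 0]°) (y - u).
    by rewrite FC.
  split; first by exists y.
  apply: lt0_polyhedral_interior => i Bi0.
  by rewrite ltNge; apply/negP => le0; case: (noi i).
case: hfeas => -[y0 t0] feas0.
(* For fixed [t] the map sending [x] to [a - x + t *: k] is an involution, so feasibility becomes a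
   preimage condition on [H]. *)
have flipK x t : a - (a - x + t *: k) + t *: k = x.
  by rewrite opprD opprB addrA subrK addrC subrK.
have feasP y t : feasible F a H k (y, t) <-> F y /\ H (a - y + t *: k).
  split=> [[Fy [x Hx /= xy]]|[Fy Hy]]; first by split=> //; rewrite -xy flipK.
  split => //=; exists (a - y + t *: k) => //; exact: flipK.
have [M MP] : exists M, forall y t, feasible F a H k (y, t) -> t <= t0 ->
    `|y| <= M /\ `|t| <= M.
  have /choice[M MP] i : exists M, row i B != 0 -> forall x t, H x -> t <= t0 ->
      0 <= row_form B i (a - x + t *: k - u) ->
      `|a - x + t *: k| <= M /\ `|t| <= M.
    have [Bi0|Bi0] := eqVneq (row i B) 0; first by exists 0.
    have [M MP] := halfspace_translate_bounded u a t0 H_closed H_convex Hh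
      (formk i Bi0) (fun x Hx xh => intC x Hx xh i Bi0).
    by exists M.
  (* The row [i] depends on the feasible pair; this sum dominates the bounds of all rows at once. *)
  exists (\sum_i `|M i|) => y t [/= Fy [x Hx xy]] tt0.
  have [i Bi0 yi] := Fform y Fy.
  have MiM : M i <= \sum_i `|M i|.
    apply: le_trans (ler_norm _) _.
    by rewrite (bigD1 i) //= lerDl sumr_ge0.
  have [|yM tM] := MP i Bi0 x t Hx tt0; first by rewrite xy.
  by split; apply: le_trans MiM; rewrite // -xy.
have closedE : closed (feasible F a H k `&` [set p | p.2 <= t0]).
  have -> : feasible F a H k = [set p | F p.1] `&`
      [set p | H (a - p.1 + p.2 *: k)].
    by apply/seteqP; split => -[y t] /feasP.
  apply: closedI; [apply: closedI|].
  - exact: (proj1 (continuous_closedP _) (fun p => cvg_fst) _ F_closed).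
  - exact: (proj1 (continuous_closedP _) (@continuous_along _ _ a k) _ H_closed).
  - exact: (proj1 (continuous_closedP _) (fun p => cvg_snd) _ (@closed_le R t0)).
have cptE : compact (feasible F a H k `&` [set p | p.2 <= t0]).
  have cptM : compact ([set y : 'rV[R]_l | `|y| <= M] `*` `[- M, M]).
    apply: compact_setX; last exact: segment_compact.
    apply: bounded_closed_compact.
      exists M; split; first exact: num_real.
      by move=> N MN y /= yM; apply: le_trans (ltW MN).
    exact: (proj1 (continuous_closedP _) (@norm_continuous _ _) _ (@closed_le R M)).
  apply: subclosed_compact closedE cptM _ => -[y t] [fyt /= tt0].
  have [yM tM] := MP y t fyt tt0.
  by split => //=; rewrite in_itv /= -ler_norml.
have [[y1 t1]] := compact_EVT_min (ex_intro _ (y0, t0) (conj feas0 (lexx t0)))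
  cptE (continuous_subspaceT (fun p => @cvg_snd _ _ (nbhs p.1) (nbhs p.2) _)).
rewrite inE => -[/= f1 t10] min1.
(* Feasible pairs outside the compact sublevel set have [s > t0 >= t1]. *)
have opt1 z s : feasible F a H k (z, s) -> t1 <= s.
  move=> fzs; have [st0|/ltW t0s] := leP s t0; last exact: le_trans t0s.
  by apply: (min1 (z, s)); rewrite inE.
(* All optimal points share the value [t1], so the solution set is the slice of the feasible set at
   [t1]. *)
have solE : solution_set F a H k = F `&` [set y | H (a - y + t1 *: k)].
  apply/seteqP; split => y.
    move=> [Fy [t [fyt tmin]]].
    have -> : t1 = t by apply/le_anti; rewrite (opt1 _ _ fyt) (tmin _ _ f1).
    exact/feasP.
  by move=> /feasP fy; split; [case: fy|exists t1].
split; first by exists y1; split; [case: f1|exists t1].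
rewrite solE; apply: bounded_closed_compact.
  exists M; split; first exact: num_real.
  move=> N MN y /feasP fy; apply: le_trans (ltW MN).
  exact: (MP y t1 fy t10).1.
apply: closedI => //.
exact: (proj1 (continuous_closedP _) (@continuous_reflect R _ a (t1 *: k)) _
  H_closed).
Qed.
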